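(* Let $d\ge 2$ and $1\le \ell\le d-1$, and let $G=(V,E)$ be a $\binom{d}{\ell}$-partite, $\binom{d}{\ell}$-uniform hypergraph whose parts are labeled by the $\ell$-element subsets of $[d]$, i.e. $V=\bigcup_{I\in\binom{[d]}{\ell}} V_I$. Then $G$ is representable (by points in $\mathbb{R}^d$ and axis-aligned $\ell$-dimensional affine subspaces, respecting the labeling) if and only if $G$ is vertex-separable.
   Context: Every hyperedge contains exactly one vertex of each part $V_I$. For $I\in\binom{[d]}{\ell}$, an axis-aligned $\ell$-subspace with free coordinates $I$ is a set $\{x\in\mathbb{R}^d: x_j=c_j \text{ for all } j\notin I\}$ for some constants $c_j$. $G$ is representable if there exist an injective assignment of a point $p^e\in\mathbb{R}^d$ to each hyperedge $e\in E$ and an injective assignment to each vertex $v\in V_I$ of an axis-aligned $\ell$-subspace $S^v$ with free coordinates $I$, such that for all $v\in V$, $e\in E$: $v\in e$ if and only if $p^e\in S^v$. For vertices $s,t$, an $s$--$t$ path is a sequence of vertices $s=v_1,\dots,v_r=t$ such that for each $i\in[r-1]$ the vertices $v_i,v_{i+1}$ lie in a common hyperedge. Two distinct vertices $v,v'$ of the same part $V_I$ are separable if there exists $j\in[d]\setminus I$ such that every $v$--$v'$ path contains a vertex lying in some part $V_J$ with $j\in J$; $G$ is vertex-separable if every two distinct vertices from the same part are separable. *)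

(* Defs.v *)
From mathcomp Require Import all_boot all_order all_algebra.
From mathcomp Require Import boolp classical_sets reals.

Set Implicit Arguments.
Unset Strict Implicit.
Unset Printing Implicit Defensive.

Local Open Scope ring_scope.

(* Finite simple hypergraphs whose parts are labeled by the l-subsets of
   {0, ..., d-1}: the part V_I is the fibre of [part] over I (possibly empty). *)
Record hypergraph (d l : nat) := Hypergraph {
  vertex : finType;
  part : vertex -> {set 'I_d};
  card_part : forall v, #|part v| = l;
  edges : {set {set vertex}};
  edges_part : forall (e : {set vertex}) (I : {set 'I_d}),
    e \in edges -> #|I| = l -> exists! v, v \in e /\ part v = I
}.

(* 'C(d, l)-uniformity follows from having one vertex in each part. *)
Lemma card_edge (d l : nat) (G : hypergraph d l) (e : {set vertex G}) :
  e \in edges G -> #|e| = 'C(d, l).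
Proof.
move=> eE.
have inj : {in e &, injective (@part d l G)}.
  move=> u v ue ve uv.
  have [w [_ wu]] := edges_part eE (card_part u).
  by rewrite -(wu u) // -(wu v).
rewrite -(card_in_imset inj) -[in RHS](card_ord d) -card_draws.
apply: eq_card => I; rewrite inE; apply/imsetP/eqP => [[v _ ->]|cI].
  exact: card_part.
by have [w [[we wI] _]] := edges_part eE cI; exists w.
Qed.

Section Representability.
Variables (R : realType) (d l : nat).

(* The axis-aligned subspaces with free coordinates I; the values c_j with
   j in I are irrelevant. *)
Definition axis_aligned (I : {set 'I_d}) (S : set 'rV[R]_d) : Prop :=
  exists c : 'rV[R]_d,
    S = [set x : 'rV[R]_d | forall j, j \notin I -> x ord0 j = c ord0 j]%classic.

Definition representable (G : hypergraph d l) : Prop :=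
  exists (p : {set vertex G} -> 'rV[R]_d) (S : vertex G -> set 'rV[R]_d),
    [/\ {in edges G &, injective p},
        injective S,
        forall v, axis_aligned (part v) (S v)
      & forall v e, e \in edges G -> (v \in e <-> S v (p e))].

End Representability.

Section Separability.
Variables (d l : nat) (G : hypergraph d l).

Definition adjacent (u w : vertex G) : bool :=
  [exists e in edges G, (u \in e) && (w \in e)].

Definition separable (v v' : vertex G) : Prop :=
  exists2 j : 'I_d, j \notin part v &
    forall s : seq (vertex G), path adjacent v s -> last v s = v' ->
      exists2 w, w \in v :: s & j \in part w.

Definition vertex_separable : Prop :=
  forall v v' : vertex G, v != v' -> part v = part v' -> separable v v'.

End Separability.

(* Main.v *)
Require Import Defs.
From mathcomp Require Import all_boot all_order all_algebra.
From mathcomp Require Import boolp classical_sets reals.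

(** In a representation, two vertices of a common hyperedge agree on every
    coordinate fixed by both, so the [j]-th coordinate is constant along paths
    that avoid the parts containing [j]. Conversely, let the [j]-th coordinate of
    a vertex be its connected component in the graph induced on the vertices whose
    part avoids [j], and let a hyperedge inherit the coordinates of its vertices;
    separability says exactly that a vertex is determined by its part and its
    coordinates. *)

Set Implicit Arguments.
Unset Strict Implicit.
Unset Printing Implicit Defensive.

Import GRing.Theory Num.Theory.
Local Open Scope ring_scope.

Section AxisAligned.
Variables (R : realType) (d : nat).
Implicit Types (I J : {set 'I_d}) (c x : 'rV[R]_d).

Definition axis_subspace I c : set 'rV[R]_d :=
  [set x : 'rV[R]_d | forall j, j \notin I -> x ord0 j = c ord0 j]%classic.

(** If [j] were in [I] but not in [J], moving coordinate [j] of [c] to 0 and to 1 would stay in the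
    set, yet both values would have to equal [c' ord0 j]. *)
Lemma axis_subspace_free_sub I J c c' :
  axis_subspace I c = axis_subspace J c' -> I \subset J.
Proof.
move=> eqS; apply/fintype.subsetP => j jI; apply/negPn/negP => jJ.
have shiftP a : axis_subspace J c' (\row_k (if k == j then a else c ord0 k)).
  rewrite -eqS => k kI; rewrite mxE; case: eqP => // kj.
  by rewrite kj jI in kI.
have := shiftP 0 j jJ; rewrite mxE eqxx => c'0.
have := shiftP 1 j jJ; rewrite mxE eqxx -c'0.
by move/eqP; rewrite oner_eq0.
Qed.

Lemma axis_subspace_coord I c c' j :
  axis_subspace I c = axis_subspace I c' -> j \notin I ->
  c ord0 j = c' ord0 j.
Proof.
by move=> eqS; have : axis_subspace I c c by []; rewrite eqS => /(_ j).
Qed.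

End AxisAligned.

Section Hypergraph.
Variables (d l : nat) (G : hypergraph d l).
Implicit Types (u v w : vertex G) (e : {set vertex G}).

Lemma adjacentP u w :
  reflect (exists2 e, e \in edges G & u \in e /\ w \in e) (adjacent u w).
Proof.
apply: (iffP exists_inP) => [[e eE /andP[ue we]]|[e eE [ue we]]].
  by exists e.
by exists e; rewrite // ue.
Qed.

Lemma adjacent_sym : symmetric (@adjacent d l G).
Proof.
by move=> u w; apply/adjacentP/adjacentP => -[e eE [? ?]]; exists e.
Qed.

(** Vertices whose part contains [j] are kept as isolated points, so components are defined on the
    whole vertex type. *)
Definition adjacent_off (j : 'I_d) : rel (vertex G) :=
  [rel u w | [&& adjacent u w, j \notin part u & j \notin part w]].

Lemma connect_off_sym j : connect_sym (adjacent_off j).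
Proof.
apply: sym_connect_sym => u w; rewrite /adjacent_off /=.
by rewrite adjacent_sym [(j \notin part u) && _]andbC.
Qed.

Lemma path_adjacent_off j v s :
  j \notin part v -> path (adjacent_off j) v s =
    path (@adjacent d l G) v s && all (fun w => j \notin part w) s.
Proof.
elim: s v => //= w s IHs v jv; rewrite {1}/adjacent_off /= jv /=.
case: (boolP (j \in part w)) => jw; first by rewrite /= !andbF.
by rewrite IHs // andbT andbA.
Qed.

Lemma separableP v v' :
  separable v v' <->
  exists2 j, j \notin part v & ~~ connect (adjacent_off j) v v'.
Proof.
split=> -[j jv sep]; exists j => //.
  apply/negP => /connectP[s]; rewrite path_adjacent_off // => /andP[vs js] lasts.
  have [w] := sep s vs (esym lasts).
  rewrite inE => /predU1P[->|ws] jw; first by rewrite jw in jv.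
  by have := allP js w ws; rewrite jw.
move=> s vs lasts; case: (boolP (has (fun w => j \in part w) s)) => [|js].
  by move=> /hasP[w ws jw]; exists w; rewrite // inE ws orbT.
case/negP: sep; apply/connectP; exists s => //.
by rewrite path_adjacent_off // vs all_predC.
Qed.

(** This contrapositive form serves both directions: it turns separability into a criterion for
    equality of vertices. *)
Lemma vertex_separableP :
  vertex_separable G <->
  forall v v', part v = part v' ->
    (forall j, j \notin part v -> connect (adjacent_off j) v v') -> v = v'.
Proof.
split=> [sep v v' eqI conn | conn v v' neq eqI].
  apply/eqP/negPn/negP => neq.
  have [j jv] := (separableP v v').1 (sep v v' neq eqI).
  by rewrite conn.
apply/separableP; apply: contrapT => nsep; case/eqP: neq.
apply: conn => // j jv; apply/negPn/negP => nconn.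
by apply: nsep; exists j.
Qed.

Section Construction.
Variable R : realType.

(** A component is encoded by the rank of its canonical root; the cast of naturals into [R] is
    injective, so distinct components get distinct reals. *)
Definition component_coord v : 'rV[R]_d :=
  \row_j (enum_rank (fingraph.root (adjacent_off j) v))%:R.

(** On a hyperedge the choice made by [pick] is immaterial: its vertices avoiding [j] are pairwise
    adjacent, hence in one component. The value 0 is a default for sets without such a vertex. *)
Definition edge_point e : 'rV[R]_d :=
  \row_j (if [pick v in e | j \notin part v] is Some v
          then component_coord v ord0 j else 0).

Lemma component_coord_eq v w j :
  component_coord v ord0 j = component_coord w ord0 j <->
  connect (adjacent_off j) v w.
Proof.
rewrite !mxE -(fingraph.root_connect (connect_off_sym j)); split=> [/eqP|/eqP-> //].
by rewrite eqr_nat => /eqP/val_inj/enum_rank_inj/eqP.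
Qed.

Lemma edge_point_coord e v j :
  e \in edges G -> v \in e -> j \notin part v ->
  edge_point e ord0 j = component_coord v ord0 j.
Proof.
move=> eE ve jv; rewrite [LHS]mxE; case: pickP => [w /andP[we jw]|/(_ v)].
  apply/component_coord_eq/connect1; rewrite /adjacent_off /= jw jv !andbT.
  by apply/adjacentP; exists e.
by rewrite ve jv.
Qed.

Lemma vertex_separable_representable :
  vertex_separable G -> representable R G.
Proof.
move/vertex_separableP => sep.
pose S v := axis_subspace (part v) (component_coord v).
have incid v e : e \in edges G -> v \in e <-> S v (edge_point e).
  move=> eE; split=> [ve j jv|Sve]; first exact: edge_point_coord.
  (* The vertex [w] of [e] in the part of [v] has the coordinates of the edge point, as [v] does, so
     separability forces [v = w]. *)
  have [w [[we wI] _]] := edges_part eE (card_part v).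
  rewrite (sep v w) // => j jv; apply/component_coord_eq.
  by rewrite -Sve // (edge_point_coord eE we) // wI.
exists edge_point, S; split=> //.
(* By incidence, a hyperedge is recovered from its point as the set of vertices whose subspaces
   contain it. *)
- move=> e e' eE e'E eq_p; apply/setP => v; apply/idP/idP.
    by move/(incid v e eE); rewrite eq_p => /(incid v e' e'E).
  by move/(incid v e' e'E); rewrite -eq_p => /(incid v e eE).
- move=> v w; rewrite /S => eqS.
  have eqI : part v = part w.
    apply/eqP; rewrite finset.eqEsubset (axis_subspace_free_sub eqS).
    exact: axis_subspace_free_sub (esym eqS).
  apply: sep => // j jv; apply/component_coord_eq.
  by apply: (axis_subspace_coord _ jv); rewrite eqS eqI.
- by move=> v; exists (component_coord v).
Qed.

End Construction.

Lemma representable_vertex_separable (R : realType) :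
  representable R G -> vertex_separable G.
Proof.
move=> [p [S [_ injS /choice[c cS] incid]]]; apply/vertex_separableP => v v' eqI conn.
have step j u w : connect (adjacent_off j) u w -> c u ord0 j = c w ord0 j.
  move=> /connectP[s + ->]; elim: s u => //= w' s IHs u /andP[+ /IHs <-].
  move=> /and3P[/adjacentP[e eE [ue we]] ju jw].
  (* The point [p e] lies on both subspaces, and each of them fixes its coordinate [j]. *)
  move: ue we => /(incid _ _ eE) + /(incid _ _ eE).
  by rewrite !cS => /(_ j ju) <- /(_ j jw).
apply: injS; rewrite !cS -eqI; apply/seteqP; split=> x Sx j jv.
  by rewrite Sx // (step j v v') // conn.
by rewrite Sx // (step j v v') // conn.
Qed.

End Hypergraph.

Theorem theorem11 (R : realType) (d l : nat)
    (hd : (2 <= d)%N) (hl : (1 <= l <= d - 1)%N) (G : hypergraph d l) :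
  representable R G <-> vertex_separable G.
Proof.
split; first exact: representable_vertex_separable.
exact: vertex_separable_representable.
Qed.
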